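(* Let $\bm A\in\mathbb R^{m\times n}$, $\bm D\in\mathbb R^{n\times d}$ with $\bm D\bm D^\top=\bm I_n$, $0<\alpha\le1$, $\lambda>0$, let $s\ge2$ be an integer, and let $\bm b=\bm A\bm x+\bm e$ with $\bm x\in\mathbb R^n$, $\|\bm e\|_2\le\lambda$. Let $T$ be an index set of $s$ largest-magnitude entries of $\bm D^\top\bm x$, and let $\hat{\bm x}$ be a minimizer of $$\min_{\bm x\in\mathbb R^n}\ \lambda\big(\|\bm D^\top\bm x\|_1-\alpha\|\bm D^\top\bm x\|_2\big)+\tfrac12\|\bm A\bm x-\bm b\|_2^2.$$ Set $K=\sqrt{\frac{\alpha+\sqrt s}{\sqrt s}+\frac{\alpha^2}{4s}}+\frac{\alpha+1}{2\sqrt s}+1$. (i) Let $t\ge3$ be real and suppose $\rho:=\rho_{s,t}=\delta_{ts}+\sqrt{\frac{\lceil(t-1)s\rceil}{(t-1)^2s}}\frac{(\sqrt2+1)(\sqrt s+\alpha)}{\sqrt2(\sqrt s-1)}\theta_{ts,(t-1)s}<1$. Set $\delta:=\delta_{ts}$, $\tau=\frac{(\sqrt2+1)\theta_{ts,(t-1)s}}{\sqrt2(1-\rho)}\frac{\sqrt{(t-1)s}}{(t-1)(s-\sqrt s)}$, $C=1+\frac{(\sqrt2+1)\theta_{ts,(t-1)s}}{\sqrt2(1-\rho)}\frac{\sqrt s+\alpha}{s-\sqrt s}\frac{\sqrt{(t-1)s}}{t-1}$, and $Q=C(1-\rho)+(\sqrt s+\alpha)\sqrt{1+\delta}$. Then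 $$\|\hat{\bm x}-\bm x\|_2\le\Big(K\Big(\tau+\frac{(\tau(1-\rho)+\sqrt{1+\delta})C}{Q}\Big)+\frac12\Big(1+\frac{C(1-\rho)}{Q}\Big)\Big)2\|\bm D_{T^c}^\top\bm x\|_1+\Big(K\frac{\tau(1-\rho)+\sqrt{1+\delta}}{1-\rho}+\frac12\Big)\Big(C+\frac{(\sqrt s+\alpha)\sqrt{1+\delta}}{1-\rho}\Big)2\lambda.$$ (ii) Suppose instead $\rho:=\rho_s=\delta_s+\frac{(\sqrt2+1)(\sqrt s+\alpha)}{\sqrt2(\sqrt s-1)}\theta_{s,s}<1$, and set $\delta:=\delta_s$, $\tau=\frac{(\sqrt2+1)\theta_{s,s}}{\sqrt2(1-\rho)}\frac1{\sqrt s-1}$, $C=1+\frac{(\sqrt2+1)\theta_{s,s}}{\sqrt2(1-\rho)}\frac{\sqrt s+\alpha}{\sqrt s-1}$, $Q=C(1-\rho)+(\sqrt s+\alpha)\sqrt{1+\delta}$. Then the same bound as in (i) holds with these $\rho,\delta,\tau,C,Q$.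
   Context: For an index set $S\subseteq\{1,\dots,d\}$, $S^c$ is its complement and $\bm D_S$ denotes $\bm D$ with all columns not indexed by $S$ set to zero (so $\bm D_{T^c}^\top\bm x$ is $\bm D^\top\bm x$ with entries in $T$ set to zero). A vector is $s$-sparse if it has at most $s$ nonzero entries. $\delta_s$ (the $\bm D$-RIC) is the smallest $\delta\ge0$ with $(1-\delta)\|\bm D\bm v\|_2^2\le\|\bm A\bm D\bm v\|_2^2\le(1+\delta)\|\bm D\bm v\|_2^2$ for all $s$-sparse $\bm v\in\mathbb R^d$; $\theta_{s,t}$ (the $\bm D$-ROC) is the smallest nonnegative number with $|\langle\bm A\bm D\bm u,\bm A\bm D\bm v\rangle-\langle\bm D\bm u,\bm D\bm v\rangle|\le\theta_{s,t}\|\bm u\|_2\|\bm v\|_2$ for all $s$-sparse $\bm u$ and $t$-sparse $\bm v$ in $\mathbb R^d$. For non-integer orders, $\delta_{ts}:=\delta_{\lceil ts\rceil}$ and $\theta_{ts,(t-1)s}:=\theta_{\lceil ts\rceil,\lceil(t-1)s\rceil}$. *)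

(* Defs.v *)
From HB Require Import structures.
From mathcomp Require Import all_boot all_order all_algebra.
From mathcomp Require Import reals.
Set Implicit Arguments. Unset Strict Implicit. Unset Printing Implicit Defensive.
Import Order.TTheory GRing.Theory Num.Theory.
Local Open Scope ring_scope.

Section Defs.
Variable R : realType.

Definition dotv n (u v : 'cV[R]_n) : R := \sum_(i < n) u i ord0 * v i ord0.
Definition norm2 n (v : 'cV[R]_n) : R := Num.sqrt (\sum_(i < n) (v i ord0) ^+ 2).
Definition norm1 n (v : 'cV[R]_n) : R := \sum_(i < n) `|v i ord0|.

Definition sparse d (s : nat) (v : 'cV[R]_d) : Prop :=
  (#|[set i | v i ord0 != 0%R]| <= s)%N.

Definition colrestr n d (D : 'M[R]_(n, d)) (S : {set 'I_d}) : 'M[R]_(n, d) :=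
  \matrix_(i, j) (if j \in S then D i j else 0).

Definition DRIP m n d (A : 'M[R]_(m, n)) (D : 'M[R]_(n, d)) (s : nat) (delta : R) :=
  forall v : 'cV[R]_d, sparse s v ->
    (1 - delta) * norm2 (D *m v) ^+ 2 <= norm2 (A *m (D *m v)) ^+ 2 /\
    norm2 (A *m (D *m v)) ^+ 2 <= (1 + delta) * norm2 (D *m v) ^+ 2.

Definition is_DRIC m n d (A : 'M[R]_(m, n)) (D : 'M[R]_(n, d)) (s : nat) (delta : R) :=
  [/\ 0 <= delta, DRIP A D s delta &
      forall delta', 0 <= delta' -> DRIP A D s delta' -> delta <= delta'].

Definition DROP m n d (A : 'M[R]_(m, n)) (D : 'M[R]_(n, d)) (s t : nat) (theta : R) :=
  forall u v : 'cV[R]_d, sparse s u -> sparse t v ->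
    `|dotv (A *m (D *m u)) (A *m (D *m v)) - dotv (D *m u) (D *m v)|
      <= theta * norm2 u * norm2 v.

Definition is_DROC m n d (A : 'M[R]_(m, n)) (D : 'M[R]_(n, d)) (s t : nat) (theta : R) :=
  [/\ 0 <= theta, DROP A D s t theta &
      forall theta', 0 <= theta' -> DROP A D s t theta' -> theta <= theta'].

(* ceiling of a real as a natural number (argument is nonnegative here) *)
Definition ceiln (x : R) : nat := `|Num.ceil x|%N.

Definition objective m n d (A : 'M[R]_(m, n)) (D : 'M[R]_(n, d)) (b : 'cV[R]_m)
  (lambda alpha : R) (z : 'cV[R]_n) : R :=
  lambda * (norm1 (D^T *m z) - alpha * norm2 (D^T *m z))
  + 2^-1 * norm2 (A *m z - b) ^+ 2.

Definition err_bound (K tau C Q rho delta alpha ssqrt tail lambda : R) : R :=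
  (K * (tau + (tau * (1 - rho) + Num.sqrt (1 + delta)) * C / Q)
     + 2^-1 * (1 + C * (1 - rho) / Q)) * (2 * tail)
  + (K * ((tau * (1 - rho) + Num.sqrt (1 + delta)) / (1 - rho)) + 2^-1)
    * (C + (ssqrt + alpha) * Num.sqrt (1 + delta) / (1 - rho)) * (2 * lambda).

End Defs.

(* Main.v *)
Require Import Defs.
From HB Require Import structures.
From mathcomp Require Import all_boot all_order all_algebra.
From mathcomp Require Import reals ring lra.
Import Order.TTheory GRing.Theory Num.Theory.
Local Open Scope ring_scope.

(** Put h = xhat - x, w = D^T h, and let T0 index the s largest entries of |w|.
    Comparing the objective at xhat and x gives the cone condition
      |w_T0c|_1 - |w_T0c|_2 <= (sqrt s + alpha) |w_T0|_2 + 2 tail + |A h|_2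
    together with a quadratic inequality for |A h|_2. A vector v with
    |v|_oo <= phi and |v|_1 - |v|_2 <= (N - sqrt N) phi satisfies
    |v|_1 <= N phi, because |v|_2^2 <= phi |v|_1; hence a linear functional
    is at most as large at v as at some N-sparse vector of norm at most
    sqrt N phi, and the D-ROC bound for sparse vectors extends to v. Applied
    to the complement of a set U containing T0 this bounds |w_U|_2 by |A h|_2
    and tail. In part (i), U also collects the entries above phi / (t - 1);
    in part (ii), U = T0. The factor (sqrt 2 + 1) / sqrt 2 of the statement is
    slack, used only to absorb the rounding in ceil((t - 1) s). *)

(** * Scalar inequalities behind the constants of the bound *)

Section RealInequalities.
Set Implicit Arguments.
Unset Strict Implicit.
Variable R : realType.

(** In the application [p] is the 2-norm of w on T0 and [a] that of A h. Inserting the bound on [p]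
    into the one on [a] leaves a quadratic inequality in [a] alone; solving it and substituting back
    reproduces [err_bound]. *)
Lemma err_bound_ge
  (K tau C Q rho delta alpha sq tail lambda p a : R) :
  0 < lambda -> 0 <= alpha -> 0 < sq -> 0 <= tau -> 0 <= K -> rho < 1 ->
  0 <= tail -> 0 <= p -> 0 <= a ->
  C = 1 + (sq + alpha) * tau ->
  Q = C * (1 - rho) + (sq + alpha) * Num.sqrt (1 + delta) ->
  (1 - rho) * p <= Num.sqrt (1 + delta) * a + tau * (1 - rho) * (2 * tail + a) ->
  a ^+ 2 - 2 * lambda * a <= 2 * lambda * ((sq + alpha) * p + 2 * tail) ->
  K * p + 2^-1 * (2 * tail + a)
    <= err_bound K tau C Q rho delta alpha sq tail lambda.
Proof.
move=> l0 al0 sq0 tau0 K0 rho1 tail0 p0 a0 defC defQ Hp Ha.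
rewrite /err_bound; set B := Num.sqrt (1 + delta) in defQ Hp *.
have B0 : 0 <= B by exact: sqrtr_ge0.
pose r := 1 - rho; have r0 : 0 < r by rewrite subr_gt0.
rewrite -/r in defQ Hp *.
set g := sq + alpha in defC defQ Ha *.
have g0 : 0 < g by rewrite /g; lra.
have C1 : 1 <= C by rewrite defC lerDl mulr_ge0 // ltW.
have Q0 : 0 < Q by rewrite defQ ltr_pwDl ?mulr_gt0 ?mulr_ge0 //; lra.
pose M := 2 * lambda * (Q / r) + C * (2 * tail) * r / Q.
have p_le : p <= tau * (2 * tail) + (tau * r + B) / r * a.
  rewrite -(ler_pM2l r0); apply: le_trans Hp _.
  by rewrite le_eqVlt; apply/orP; left; apply/eqP; field; lra.
have a_le : a <= M.
  have a2 : a ^+ 2 <= 2 * lambda * (C * (2 * tail) + Q / r * a).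
    have e1 : C * (2 * tail) + Q / r * a
        = g * (tau * (2 * tail) + (tau * r + B) / r * a) + 2 * tail + a.
      by rewrite defQ defC; field; lra.
    rewrite e1; have := ler_wpM2l (ltW g0) p_le => gp.
    have : 2 * lambda * (g * p) <=
        2 * lambda * (g * (tau * (2 * tail) + (tau * r + B) / r * a)).
      by rewrite ler_wpM2l //; lra.
    lra.
  (* The quadratic reads [a ^+ 2 <= P * q + P * a]. If [a > P + q], then [a * (a - P)] would exceed
     [a * q], which is at least [P * q]. *)
  pose P := 2 * lambda * (Q / r); pose q := C * (2 * tail) * r / Q.
  have P0 : 0 < P by rewrite /P mulr_gt0 ?divr_gt0 //; lra.
  have q0 : 0 <= q by rewrite /q !(mulr_ge0, invr_ge0) //; lra.
  have Pq : 2 * lambda * (C * (2 * tail)) = P * q by rewrite /P /q; field; lra.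
  rewrite leNgt; apply/negP; rewrite /M -/P -/q => lt.
  have a2' : a ^+ 2 <= P * q + P * a by rewrite -Pq /P; lra.
  have pos : 0 < a * (a - (P + q)) by rewrite mulr_gt0; lra.
  have pos2 : 0 <= q * (a - P) by rewrite mulr_ge0 //; lra.
  lra.
have -> : (K * (tau + (tau * r + B) * C / Q) + 2^-1 * (1 + C * r / Q)) * (2 * tail)
   + (K * ((tau * r + B) / r) + 2^-1) * (C + g * B / r) * (2 * lambda)
   = K * (tau * (2 * tail) + (tau * r + B) / r * M) + 2^-1 * (2 * tail + M).
  have -> : C + g * B / r = Q / r by rewrite defQ; field; lra.
  by rewrite /M; field; lra.
have c0 : 0 <= (tau * r + B) / r.
  by rewrite divr_ge0 ?(ltW r0) // addr_ge0 // mulr_ge0 // ltW.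
have := ler_wpM2l c0 a_le => ca.
apply: lerD; last lra.
by rewrite ler_wpM2l //; lra.
Qed.

(** The origin of K. With q = p / sq, completing the square in y gives (y - alpha q / 2)^2 <= (kap
    p)^2 + q r, and q r <= ((q + r) / 2)^2 bounds the right side by (kap p + (q + r) / 2)^2. *)
Lemma tail_norm_le (sq alpha p y r : R) :
  0 < sq -> 0 <= alpha -> 0 <= p -> 0 <= y -> 0 <= r ->
  y ^+ 2 <= p / sq * ((sq + alpha) * p + alpha * y + r) ->
  p + y <= (Num.sqrt ((alpha + sq) / sq + alpha ^+ 2 / (4 * sq ^+ 2))
            + (alpha + 1) / (2 * sq) + 1) * p + 2^-1 * r.
Proof.
move=> sq0 al0 p0 y0 r0 Hy.
have arg0 : 0 <= (alpha + sq) / sq + alpha ^+ 2 / (4 * sq ^+ 2).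
  by rewrite addr_ge0 // divr_ge0 ?mulr_ge0 ?sqr_ge0 ?addr_ge0 // ltW.
set kap := Num.sqrt _; have kap0 : 0 <= kap by exact: sqrtr_ge0.
have kap2 : kap ^+ 2 = (alpha + sq) / sq + alpha ^+ 2 / (4 * sq ^+ 2).
  by rewrite sqr_sqrtr.
pose q := p / sq; have q0 : 0 <= q by rewrite divr_ge0 // ltW.
have pq : p = q * sq by rewrite /q; field; lra.
have kp2 : (kap * p) ^+ 2 = (alpha + sq) * sq * q ^+ 2 + alpha ^+ 2 * q ^+ 2 / 4.
  by rewrite exprMn kap2 pq; field; lra.
have kp0 : 0 <= kap * p by rewrite mulr_ge0.
have -> : (kap + (alpha + 1) / (2 * sq) + 1) * p + 2^-1 * r
    = p + (kap * p + alpha * q / 2 + (q + r) / 2).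
  by rewrite pq; field; lra.
rewrite lerD2l leNgt; apply/negP => lt.
move: Hy; rewrite -/q {1}pq => Hy.
have alq0 : 0 <= alpha * q by rewrite mulr_ge0.
pose X := y - alpha * q / 2; pose Y := kap * p + (q + r) / 2.
have Y0 : 0 <= Y by rewrite /Y; lra.
have XY : Y < X by rewrite /X /Y; lra.
have : 0 < (X - Y) * (X + Y) by rewrite mulr_gt0; lra.
have : 0 <= kap * p * (q + r) by rewrite mulr_ge0 // addr_ge0.
have := sqr_ge0 (q - r).
move: kp2; rewrite /X /Y; set kp := kap * p => kp2; lra.
Qed.

(** With z the square root, two values of z^2 - z differ by (z' - z)(z' + z - 1). This monotonicity
    allows (t - 1) s to be rounded up in part (i). *)
Lemma sub_sqrt_le (M N : R) : 1 <= M -> M <= N -> M - Num.sqrt M <= N - Num.sqrt N.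
Proof.
move=> M1 MN.
have M0 : 0 <= M by lra.
have N0 : 0 <= N by lra.
have sM1 : 1 <= Num.sqrt M by rewrite -sqrtr1 ler_sqrt.
have sMN : Num.sqrt M <= Num.sqrt N by rewrite ler_sqrt.
rewrite -{1}(sqr_sqrtr M0) -{1}(sqr_sqrtr N0) -subr_ge0.
have : 0 <= (Num.sqrt N - Num.sqrt M) * (Num.sqrt N + Num.sqrt M - 1).
  by rewrite mulr_ge0; lra.
lra.
Qed.

Lemma le_of_sub_sqrt (M k : R) : 1 <= M -> k - Num.sqrt k <= M - Num.sqrt M -> k <= M.
Proof.
move=> M1 H; rewrite leNgt; apply/negP => Mk.
have M0 : 0 <= M by lra.
have k0 : 0 <= k by lra.
have sM1 : 1 <= Num.sqrt M by rewrite -sqrtr1 ler_sqrt.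
have sMk : Num.sqrt M < Num.sqrt k by rewrite ltr_sqrt //; lra.
move: H; rewrite -{1}(sqr_sqrtr M0) -{1}(sqr_sqrtr k0).
have : 0 < (Num.sqrt k - Num.sqrt M) * (Num.sqrt k + Num.sqrt M - 1).
  by rewrite mulr_gt0; lra.
lra.
Qed.

Lemma sqrt_le (x y : R) : 0 <= y -> x <= y ^+ 2 -> Num.sqrt x <= y.
Proof. by move=> y0 xy; rewrite -(ger0_norm y0) -sqrtr_sqr ler_sqrt ?sqr_ge0. Qed.

Lemma ceiln_bounds (x : R) : 0 <= x -> x <= (ceiln x)%:R < x + 1.
Proof.
move=> x0; have c0 : 0 <= Num.ceil x by rewrite ceil_ge0; lra.
rewrite /ceiln natr_absz ger0_norm // ceil_ge /=.
by have := ceilB1_lt x; rewrite intrB; lra.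
Qed.

Lemma sqrt2_ratio_ge : 3 / 2 <= (Num.sqrt 2 + 1) / Num.sqrt 2 :> R.
Proof.
have sqrt20 : 0 < Num.sqrt 2 :> R by rewrite sqrtr_gt0.
have sqrt22 : Num.sqrt 2 <= 2 :> R by apply: sqrt_le; lra.
by rewrite ler_pdivlMr //; lra.
Qed.

(** Put kappa = (sqrt 2 + 1) / sqrt 2. In [rho] the factor kappa multiplies
    [theta * G * (sq + alpha)] exactly, so kappa >= 1 suffices there; [tau] has sqrt ((t - 1) S)
    where [G] has sqrt N, and kappa must cover their ratio. *)
Lemma constants_large (S sq t N alpha delta theta rho tau G : R) :
  1 < sq -> S = sq ^+ 2 -> 3 <= t -> 0 <= alpha -> 0 <= theta ->
  4 <= (t - 1) * S -> (t - 1) * S <= N -> N <= (t - 1) * S + 1 ->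
  rho = delta + Num.sqrt (N / ((t - 1) ^+ 2 * S))
        * ((Num.sqrt 2 + 1) * (sq + alpha) / (Num.sqrt 2 * (sq - 1))) * theta ->
  rho < 1 ->
  tau = (Num.sqrt 2 + 1) * theta / (Num.sqrt 2 * (1 - rho))
        * (Num.sqrt ((t - 1) * S) / ((t - 1) * (S - sq))) ->
  G = Num.sqrt N / ((t - 1) * (S - sq)) ->
  [/\ 0 <= G, delta + theta * G * (sq + alpha) <= rho, 0 <= tau &
      theta * G <= tau * (1 - rho)].
Proof.
move=> sq1 SE t3 al0 th0 M4 MN NM rhoE rho1 tauE GE.
have t10 : 0 < t - 1 by lra.
have SsqE : S - sq = sq * (sq - 1) by rewrite SE; ring.
have Ssq : 0 < S - sq by rewrite SsqE mulr_gt0; lra.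
have den0 : 0 < (t - 1) * (S - sq) by rewrite mulr_gt0.
have N0 : 0 <= N by lra.
have r1 : 0 < 1 - rho by rewrite subr_gt0.
have kappa := sqrt2_ratio_ge.
have sqrt20 : Num.sqrt 2 != 0 :> R by rewrite gt_eqF // sqrtr_gt0.
have sqrtN : Num.sqrt (N / ((t - 1) ^+ 2 * S)) = Num.sqrt N / ((t - 1) * sq).
  rewrite SE -exprMn sqrtrM // sqrtrV ?sqr_ge0 // sqrtr_sqr ger0_norm //.
  by rewrite mulr_ge0; lra.
set M := (t - 1) * S in M4 MN NM tauE.
have sqrtNM : Num.sqrt N <= (Num.sqrt 2 + 1) / Num.sqrt 2 * Num.sqrt M.
  (* The constant 3 / 2 works because N <= M + 1 <= (9 / 4) M when M >= 4. *)
  apply: (@le_trans _ _ (3 / 2 * Num.sqrt M)); last by rewrite ler_wpM2r ?sqrtr_ge0.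
  apply: sqrt_le; first by rewrite mulr_ge0 ?sqrtr_ge0 //; lra.
  by rewrite exprMn sqr_sqrtr; lra.
move: rhoE; rewrite {}sqrtN => rhoE.
move: (Num.sqrt 2) kappa sqrt20 sqrtNM tauE rhoE => sqrt2 kappa sqrt20.
move: (sqrtr_ge0 N) (sqrtr_ge0 M); move: (Num.sqrt N) (Num.sqrt M) GE.
move=> y z GE y0 z0 yz tauE rhoE.
have G0 : 0 <= G by rewrite GE divr_ge0 // ltW.
have tG : 0 <= theta * G * (sq + alpha) by rewrite !mulr_ge0 //; lra.
have rhoE' : rho = delta + (sqrt2 + 1) / sqrt2 * (theta * G * (sq + alpha)).
  by rewrite rhoE GE SsqE; field; rewrite sqrt20 /=; lra.
have tauE' : tau * (1 - rho) = theta * ((sqrt2 + 1) / sqrt2 * z) / ((t - 1) * (S - sq)).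
  by rewrite tauE; field; rewrite sqrt20 /=; lra.
have tau_ge : theta * G <= tau * (1 - rho).
  by rewrite tauE' GE mulrA ler_wpM2r ?invr_ge0 ?(ltW den0) // ler_wpM2l.
split=> //.
  by rewrite rhoE' lerD2l ler_peMl //; lra.
rewrite -(pmulr_lge0 _ r1); apply: le_trans tau_ge; exact: mulr_ge0.
Qed.

(** Here N = s, so sqrt N / (s - sqrt s) reduces to 1 / (sqrt s - 1); nothing is rounded. *)
Lemma constants_s (sq alpha delta theta rho tau : R) :
  1 < sq -> 0 <= alpha -> 0 <= theta ->
  rho = delta + (Num.sqrt 2 + 1) * (sq + alpha) / (Num.sqrt 2 * (sq - 1)) * theta ->
  rho < 1 ->
  tau = (Num.sqrt 2 + 1) * theta / (Num.sqrt 2 * (1 - rho)) * (1 / (sq - 1)) ->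
  [/\ 0 <= (sq - 1)^-1, delta + theta * (sq - 1)^-1 * (sq + alpha) <= rho, 0 <= tau &
      theta * (sq - 1)^-1 <= tau * (1 - rho)].
Proof.
move=> sq1 al0 th0 rhoE rho1 tauE.
have r1 : 0 < 1 - rho by rewrite subr_gt0.
have G0 : 0 <= (sq - 1)^-1 by rewrite invr_ge0; lra.
have kappa := sqrt2_ratio_ge.
have sqrt20 : Num.sqrt 2 != 0 :> R by rewrite gt_eqF // sqrtr_gt0.
move: (Num.sqrt 2) kappa sqrt20 tauE rhoE => sqrt2 kappa sqrt20 tauE rhoE.
have tG : 0 <= theta * (sq - 1)^-1 by rewrite mulr_ge0.
have tGs : 0 <= theta * (sq - 1)^-1 * (sq + alpha) by rewrite mulr_ge0 //; lra.
have rhoE' : rho = delta + (sqrt2 + 1) / sqrt2 * (theta * (sq - 1)^-1 * (sq + alpha)).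
  by rewrite rhoE; field; rewrite sqrt20 /=; lra.
have tauE' : tau * (1 - rho) = (sqrt2 + 1) / sqrt2 * (theta * (sq - 1)^-1).
  by rewrite tauE; field; rewrite sqrt20 /=; lra.
have tau_ge : theta * (sq - 1)^-1 <= tau * (1 - rho).
  by rewrite tauE' ler_peMl //; lra.
split=> //.
  by rewrite rhoE' lerD2l ler_peMl //; lra.
by rewrite -(pmulr_lge0 _ r1); apply: le_trans tau_ge.
Qed.

End RealInequalities.

(** * Norms, restrictions to index sets, and the functional |.|_1 - |.|_2 *)

Section Norms.
Set Implicit Arguments.
Unset Strict Implicit.
Variables (R : realType) (d : nat).
Implicit Types (u v : 'cV[R]_d) (S : {set 'I_d}).

Lemma dotvC u v : dotv u v = dotv v u.
Proof. by apply: eq_bigr => i _; rewrite mulrC. Qed.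

Lemma dotvDl u u' v : dotv (u + u') v = dotv u v + dotv u' v.
Proof. by rewrite -big_split; apply: eq_bigr => i _ /=; rewrite mxE mulrDl. Qed.

Lemma dotvDr u v v' : dotv u (v + v') = dotv u v + dotv u v'.
Proof. by rewrite dotvC dotvDl !(dotvC u). Qed.

Lemma dotvZl c u v : dotv (c *: u) v = c * dotv u v.
Proof. by rewrite mulr_sumr; apply: eq_bigr => i _; rewrite mxE mulrA. Qed.

Lemma dotvZr c u v : dotv u (c *: v) = c * dotv u v.
Proof. by rewrite dotvC dotvZl dotvC. Qed.

Lemma dotv_mx u v : dotv u v = (u^T *m v) ord0 ord0.
Proof. by rewrite mxE; apply: eq_bigr => i _; rewrite mxE. Qed.

Lemma norm2_ge0 v : 0 <= norm2 v.
Proof. exact: sqrtr_ge0. Qed.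

Lemma norm1_ge0 v : 0 <= norm1 v.
Proof. exact: sumr_ge0. Qed.

Lemma norm2_sq v : norm2 v ^+ 2 = dotv v v.
Proof.
rewrite sqr_sqrtr; last by apply: sumr_ge0 => i _; exact: sqr_ge0.
by apply: eq_bigr => i _; rewrite expr2.
Qed.

Lemma norm2_sqE v : norm2 v ^+ 2 = \sum_i v i ord0 ^+ 2.
Proof. by rewrite norm2_sq; apply: eq_bigr => i _; rewrite expr2. Qed.

Lemma le_norm2 (k : nat) (u : 'cV[R]_k) c : 0 <= c ->
  norm2 u ^+ 2 <= c ^+ 2 -> norm2 u <= c.
Proof. by move=> c0; rewrite ler_pXn2r // nnegrE // sqrtr_ge0. Qed.

Lemma norm2_eq0 v : norm2 v = 0 -> v = 0.
Proof.
move=> v0; apply/colP => i; rewrite mxE; apply/eqP; rewrite -sqrf_eq0.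
have /eqP : \sum_j v j ord0 ^+ 2 = 0 by rewrite -norm2_sqE v0 expr0n.
rewrite psumr_eq0 => [/allP/(_ i)|j _]; last exact: sqr_ge0.
by rewrite mem_index_enum => /(_ isT).
Qed.

(** Cauchy-Schwarz: with a, b the norms and c the product, the squared norm of b u - a v is 2 a b (a
    b - c). Dividing by a b leaves the case a b = 0 apart. *)
Lemma dotv_le u v : dotv u v <= norm2 u * norm2 v.
Proof.
have h0 := norm2_sq (norm2 v *: u + (- norm2 u) *: v).
have := sqr_ge0 (norm2 (norm2 v *: u + (- norm2 u) *: v)).
rewrite h0 !dotvDl !dotvDr !dotvZl !dotvZr -!norm2_sq (dotvC v u).
set a := norm2 u; set b := norm2 v; set c := dotv u v => H.
have a0 : 0 <= a by exact: norm2_ge0.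
have b0 : 0 <= b by exact: norm2_ge0.
have ab0 : 0 <= a * b by exact: mulr_ge0.
have [/eqP ab|abn] := eqVneq (a * b) 0.
  suff -> : c = 0 by [].
  move: ab; rewrite mulf_eq0 => /orP[]/eqP/norm2_eq0.
    by rewrite /c => ->; rewrite -(scale0r 0) dotvZl mul0r.
  by rewrite /c => ->; rewrite -(scale0r 0) dotvZr mul0r.
have abp : 0 < a * b by rewrite lt0r abn.
by rewrite -(ler_pM2l abp); nra.
Qed.

Lemma norm2D u v : norm2 (u + v) <= norm2 u + norm2 v.
Proof.
apply: le_norm2; first by rewrite addr_ge0 ?norm2_ge0.
rewrite norm2_sq dotvDl !dotvDr (dotvC v u) -!norm2_sq.
have := dotv_le u v; lra.
Qed.

Lemma norm2_le_norm1 v : norm2 v <= norm1 v.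
Proof.
apply: le_norm2; first exact: norm1_ge0.
rewrite norm2_sqE expr2 mulr_suml; apply: ler_sum => i _.
rewrite -real_normK ?num_real // expr2 ler_wpM2l //.
by rewrite /norm1 (bigD1 i) //= lerDl sumr_ge0.
Qed.

Lemma norm2_sq_le_sup v c :
  (forall i, `|v i ord0| <= c) -> norm2 v ^+ 2 <= c * norm1 v.
Proof.
move=> vc; rewrite norm2_sqE mulr_sumr; apply: ler_sum => i _.
by rewrite -real_normK ?num_real // expr2 ler_wpM2r.
Qed.

Definition restr S v : 'cV[R]_d := \col_i (if i \in S then v i ord0 else 0).

Lemma restrE S v i : restr S v i ord0 = if i \in S then v i ord0 else 0.
Proof. by rewrite mxE. Qed.

Lemma norm1_restr S v : norm1 (restr S v) = \sum_(i in S) `|v i ord0|.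
Proof.
rewrite big_mkcond; apply: eq_bigr => i _; rewrite mxE.
by case: ifP; rewrite ?normr0.
Qed.

Lemma dotv_restr S v : dotv (restr S v) v = norm2 (restr S v) ^+ 2.
Proof.
rewrite norm2_sq; apply: eq_bigr => i _; rewrite mxE.
by case: ifP => //; rewrite !mul0r.
Qed.

Lemma restrU S S' v : [disjoint S & S'] -> restr (S :|: S') v = restr S v + restr S' v.
Proof.
move=> dSS; apply/colP => i; rewrite !mxE inE.
case: (boolP (i \in S)) => /= [iS|_]; last by rewrite add0r.
by rewrite (disjointFr dSS iS) addr0.
Qed.

Lemma restrC S v : restr S v + restr (~: S) v = v.
Proof.
apply/colP => i; rewrite !mxE inE.
by case: ifP => /= _; rewrite ?addr0 ?add0r.
Qed.

Lemma norm1_restrC S v : norm1 v = norm1 (restr S v) + norm1 (restr (~: S) v).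
Proof.
rewrite !norm1_restr /norm1 (bigID (mem S)) /=; congr (_ + _).
by apply: eq_bigl => i; rewrite inE.
Qed.

Lemma sparse_restr S v k : (#|S| <= k)%N -> sparse k (restr S v).
Proof.
apply: leq_trans; apply: subset_leq_card; apply/subsetP => i.
by rewrite inE mxE; case: ifP => //; rewrite eqxx.
Qed.

Lemma norm2_restr_le S S' v :
  S \subset S' -> norm2 (restr S v) <= norm2 (restr S' v).
Proof.
move=> sS; apply: le_norm2; first exact: norm2_ge0.
rewrite !norm2_sqE; apply: ler_sum => i _; rewrite !mxE.
case: ifP => [/(subsetP sS) -> //|_]; rewrite expr0n; exact: sqr_ge0.
Qed.

Lemma norm2_const S (c : R) : 0 <= c ->
  norm2 (restr S (const_mx c)) = Num.sqrt #|S|%:R * c.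
Proof.
move=> c0; have sq2 : norm2 (restr S (const_mx c)) ^+ 2 = (Num.sqrt #|S|%:R * c) ^+ 2.
  rewrite norm2_sqE exprMn sqr_sqrtr ?ler0n // (bigID (mem S)) /= [X in _ + X]big1 ?addr0.
    rewrite (eq_bigr (fun=> c ^+ 2)) => [|i iS]; last by rewrite !mxE iS.
    by rewrite sumr_const mulr_natl.
  by move=> i /negbTE iS; rewrite mxE iS expr0n.
by apply/eqP; rewrite -(eqrXn2 (n := 2)) ?norm2_ge0 ?mulr_ge0 ?sqrtr_ge0 // sq2.
Qed.

Lemma norm2_restr_ge S v c : 0 <= c -> (forall i, i \in S -> c <= `|v i ord0|) ->
  Num.sqrt #|S|%:R * c <= norm2 (restr S v).
Proof.
move=> c0 Sge; rewrite -norm2_const //; apply: le_norm2; first exact: norm2_ge0.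
rewrite !norm2_sqE; apply: ler_sum => i _; rewrite !restrE mxE; case: ifP => // iS.
by rewrite -[leRHS]real_normK ?num_real // ler_pXn2r ?nnegrE ?Sge.
Qed.

Lemma norm1_le_norm2 S v :
  norm1 (restr S v) <= Num.sqrt #|S|%:R * norm2 (restr S v).
Proof.
have H := dotv_le (restr S (const_mx 1)) (\col_i `|restr S v i ord0|).
have E : norm2 (\col_i `|restr S v i ord0|) = norm2 (restr S v).
  by congr Num.sqrt; apply: eq_bigr => i _; rewrite mxE real_normK ?num_real.
move: H; rewrite E norm2_const ?ler01 // mulr1; apply: le_trans.
apply: ler_sum => i _; rewrite !mxE; case: ifP => _; rewrite ?mul1r //.
by rewrite normr0 mul0r.
Qed.

(** The entries in S' but not in S add their full 1-norm to the first term and at most their 2-norm,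
    which is no larger, to the second. *)
Lemma l1l2_restr_le S S' v : S \subset S' ->
  norm1 (restr S v) - norm2 (restr S v) <= norm1 (restr S' v) - norm2 (restr S' v).
Proof.
move=> sS; have dS : [disjoint S & S' :\: S].
  by rewrite -setI_eq0; apply/eqP/setP => i; rewrite !inE; case: (i \in S).
have eS : S' = S :|: (S' :\: S).
  by apply/setP => i; rewrite !inE; case: (boolP (i \in S)) => // /(subsetP sS) ->.
have n1 : norm1 (restr S' v) = norm1 (restr S v) + norm1 (restr (S' :\: S) v).
  by rewrite !norm1_restr (big_setID S) /= (setIidPr sS).
have n2 : norm2 (restr S' v) <= norm2 (restr S v) + norm2 (restr (S' :\: S) v).
  by rewrite {1}eS (restrU _ dS) norm2D.
have := norm2_le_norm1 (restr (S' :\: S) v); lra.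
Qed.

(** On S, split |v| into the constant c and a nonnegative remainder r. The 1-norm is additive here,
    the 2-norm subadditive, and |r|_2 <= |r|_1, so r cannot lower the difference. *)
Lemma l1l2_ge S v c : 0 <= c -> (forall i, i \in S -> c <= `|v i ord0|) ->
  (#|S|%:R - Num.sqrt #|S|%:R) * c <= norm1 (restr S v) - norm2 (restr S v).
Proof.
move=> c0 cv.
pose r : 'cV[R]_d := restr S (\col_i (`|v i ord0| - c)).
have n1 : norm1 r = norm1 (restr S v) - #|S|%:R * c.
  rewrite !norm1_restr mulr_natl -sumr_const -sumrB; apply: eq_bigr => i iS.
  by rewrite mxE ger0_norm // subr_ge0 cv.
have n2 : norm2 (restr S v) = norm2 (restr S (const_mx c) + r).
  congr Num.sqrt; apply: eq_bigr => i _; rewrite !mxE.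
  by case: ifP => _; rewrite ?addr0 // subrKC real_normK ?num_real.
have := norm2D (restr S (const_mx c)) r.
have := norm2_le_norm1 r.
rewrite -n2 n1 norm2_const //; lra.
Qed.

Lemma l1l2_polytope v (N phi : R) : 1 <= N -> 0 <= phi ->
  (forall i, `|v i ord0| <= phi) ->
  norm1 v - norm2 v <= (N - Num.sqrt N) * phi -> norm1 v <= N * phi.
Proof.
move=> N1 phi0 vphi H.
have := norm2_sq_le_sup vphi.
have := norm2_ge0 v.
have sN : Num.sqrt N ^+ 2 = N by rewrite sqr_sqrtr //; lra.
have sN1 : 1 <= Num.sqrt N by rewrite -sqrtr1 ler_sqrt //; lra.
move: H; set z := Num.sqrt N in sN sN1 *.
set X := norm1 v; set Y := norm2 v; rewrite -sN => H Y0 HY.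
rewrite leNgt; apply/negP => lt.
have zphi : 0 <= z * phi by rewrite mulr_ge0 //; lra.
have Yz : z * phi < Y by lra.
have z1phi : 0 <= (z - 1) * phi by rewrite mulr_ge0 //; lra.
(* From Y^2 <= phi X and X <= Y + (z^2 - z) phi follows Y^2 - phi Y - z (z - 1) phi^2 <= 0, and this
   quadratic factors as the product below. *)
have pos : 0 < (Y - z * phi) * (Y + (z - 1) * phi) by apply: mulr_gt0; lra.
have := ler_wpM2l phi0 H; lra.
Qed.

Lemma top_set (f : 'I_d -> R) k : (k <= d)%N ->
  exists2 S : {set 'I_d}, #|S| = k &
    forall i j, i \in S -> j \notin S -> f j <= f i.
Proof.
elim: k => [_|k IH kd].
  by exists set0 => [|i j]; rewrite ?cards0 // inE.
have [S cS fS] := IH (ltnW kd).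
have [i0 i0S] : exists i, i \notin S.
  apply/existsP; rewrite -negb_forall; apply/negP => /forallP allS.
  move: kd; rewrite -cS -[d in (_ < d)%N]card_ord.
  by rewrite (eq_card (B := 'I_d)) ?ltnn // => i; rewrite allS.
case: (@Order.TotalTheory.arg_maxP _ _ _ i0 (fun i => i \notin S) f i0S) => i iS fi.
exists (i |: S) => [|a b]; first by rewrite cardsU1 iS cS.
rewrite !inE negb_or => /orP[/eqP -> /andP[_ bS]|aS /andP[_ bS]].
  exact: fi.
exact: fS.
Qed.

Lemma top_restr v k : (k <= d)%N ->
  exists S : {set 'I_d}, exists c : R,
  [/\ #|S| = k, 0 <= c, forall i, i \in S -> c <= `|v i ord0| &
      forall i, i \notin S -> `|v i ord0| <= c].
Proof.
move=> kd; have [S cS vS] := top_set (fun i => `|v i ord0|) kd.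
have [j jS|noj] := pickP (fun j => j \notin S).
  case: (@Order.TotalTheory.arg_maxP _ _ _ j (fun i => i \notin S)
           (fun i => `|v i ord0|) jS) => i iS vi.
  by exists S; exists `|v i ord0|; split=> // a aS; exact: vS.
(* When [S] contains every index, no entry outside constrains the threshold and 0 will do. *)
exists S; exists 0; split=> // i iS.
by have := noj i; rewrite iS.
Qed.

(** The threshold [c] acts as a Lagrange multiplier: f_i v_i - c |v_i| is at most (|f_i| - c) phi on
    [S] and at most 0 off it, while c |v|_1 <= c k phi. Summing yields the value of f at the
    extremal vector. *)
Lemma dotv_polytope (f v : 'cV[R]_d) (k : nat) (phi B : R) : 0 <= phi ->
  (forall i, `|v i ord0| <= phi) -> norm1 v <= k%:R * phi ->
  (forall u, sparse k u -> norm2 u <= Num.sqrt k%:R * phi -> dotv f u <= B) ->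
  dotv f v <= B.
Proof.
move=> phi0 vphi v1 HB.
have [S [c [c0 ckS fge fle Sk]]] : exists S : {set 'I_d}, exists c : R,
  [/\ 0 <= c, c * k%:R <= c * #|S|%:R, forall i, i \in S -> c <= `|f i ord0|,
      forall i, i \notin S -> `|f i ord0| <= c & (#|S| <= k)%N].
  (* For k > d the set [S] is everything, with fewer than k elements; c = 0 keeps
     [c * k%:R <= c * #|S|%:R] true. *)
  have [kd|dk] := leqP k d; last first.
    exists setT; exists 0; split=> //; rewrite ?mul0r //.
      by move=> i; rewrite inE.
    by rewrite cardsT card_ord ltnW.
  have [S [c [cS c0 fge fle]]] := top_restr f kd.
  by exists S; exists c; split; rewrite ?cS.
(* Extremal sparse vector: the signs of f, times phi, on the k largest entries of |f|. *)
pose u : 'cV[R]_d := restr S (\col_i (Num.sg (f i ord0) * phi)).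
have fu : dotv f u = \sum_(i in S) `|f i ord0| * phi.
  rewrite [RHS]big_mkcond; apply: eq_bigr => i _; rewrite !mxE.
  by case: ifP; rewrite ?mulr0 // mulrA [_ * Num.sg _]mulrC -normrEsg.
apply: le_trans (HB u _ _).
- rewrite fu.
  have le1 : dotv f v - c * norm1 v <= \sum_(i in S) (`|f i ord0| - c) * phi.
    rewrite mulr_sumr -sumrB [leRHS]big_mkcond; apply: ler_sum => i _.
    have le2 : f i ord0 * v i ord0 <= `|f i ord0| * `|v i ord0|.
      by rewrite -normrM ler_norm.
    have v0 := normr_ge0 (v i ord0); have vp := vphi i.
    by case: ifP => [/fge|/negbT/fle] fc; nra.
  move: le1; rewrite (eq_bigr (fun i => `|f i ord0| * phi - c * phi)); last first.
    by move=> i _; rewrite mulrBl.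
  rewrite sumrB sumr_const -[(c * phi) *+ _]mulr_natl; nra.
- exact: sparse_restr.
- have le1 : norm2 u <= norm2 (restr S (const_mx phi)).
    apply: le_norm2; first exact: norm2_ge0.
    rewrite !norm2_sqE; apply: ler_sum => i _; rewrite !mxE.
    case: ifP => // _; rewrite exprMn -[leRHS]mul1r ler_wpM2r ?sqr_ge0 //.
    by rewrite sqr_sg; case: eqP.
  apply: le_trans le1 _; rewrite norm2_const // ler_wpM2r // ler_sqrt ?ler0n //.
  by rewrite ler_nat.
Qed.

(** Once c is subtracted from each |v_i|, the terms are nonnegative on [S] and nonpositive off it;
    equal cardinalities make the multiples of c cancel. *)
Lemma norm1_top_le S S' v c : #|S| = #|S'| ->
  (forall i, i \in S -> c <= `|v i ord0|) ->
  (forall i, i \notin S -> `|v i ord0| <= c) ->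
  norm1 (restr S' v) <= norm1 (restr S v).
Proof.
move=> cSS vge vle; rewrite !norm1_restr -(lerD2r (- (c *+ #|S|))) {1}cSS.
rewrite -!sumr_const -!sumrB [leLHS]big_mkcond [leRHS]big_mkcond /=.
apply: ler_sum => i _.
have v0 := vge i; have v1 := vle i.
case: (boolP (i \in S)) => iS; case: ifP => // _.
  by rewrite subr_ge0 vge.
by rewrite subr_le0 vle.
Qed.

(** [U] adds to [T] the set V of outside entries above psi = phi / q. Since sqrt (q s) <= q sqrt s,
    the hypothesis passes to level psi with q s in place of s, and [l1l2_ge] on V then forces |V| <=
    q s. *)
Lemma l1l2_split v (T : {set 'I_d}) (s q phi : R) :
  2 <= s -> 1 <= q -> 0 <= phi ->
  (forall i, i \notin T -> `|v i ord0| <= phi) ->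
  norm1 (restr (~: T) v) - norm2 (restr (~: T) v) <= (s - Num.sqrt s) * phi ->
  exists U : {set 'I_d},
  [/\ T \subset U, #|U|%:R <= #|T|%:R + q * s,
      forall i, i \notin U -> `|v i ord0| <= phi / q &
      norm1 (restr (~: U) v) - norm2 (restr (~: U) v)
        <= (q * s - Num.sqrt (q * s)) * (phi / q)].
Proof.
move=> s2 q1 phi0 vT l12; set psi := phi / q.
have psi0 : 0 <= psi by rewrite divr_ge0 //; lra.
have phiE : phi = q * psi by rewrite /psi; field; lra.
have s0 : 0 <= s by lra.
have qs : s <= q * s by rewrite ler_peMl.
have sqrt_qs : Num.sqrt (q * s) <= q * Num.sqrt s.
  apply: sqrt_le; first by rewrite mulr_ge0 ?sqrtr_ge0 //; lra.
  rewrite exprMn (sqr_sqrtr s0) ler_wpM2r // expr2 ler_peMl //; lra.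
have split_le : norm1 (restr (~: T) v) - norm2 (restr (~: T) v)
    <= (q * s - Num.sqrt (q * s)) * psi.
  by apply: le_trans l12 _; rewrite phiE mulrA ler_wpM2r //; lra.
pose V := [set i | (i \notin T) && (psi < `|v i ord0|)].
have Vge i : i \in V -> psi <= `|v i ord0| by rewrite inE => /andP[_ /ltW].
have VT : V \subset ~: T by apply/subsetP => i; rewrite !inE => /andP[].
have cV : #|V|%:R <= q * s.
  (* The factor psi cannot be cancelled when it is 0, but then v vanishes off [T] and V is empty. *)
  have [psiz|psinz] := eqVneq psi 0.
    suff -> : V = set0 by rewrite cards0; lra.
    apply/setP => i; rewrite !inE; apply/negP => /andP[/vT].
    by rewrite phiE psiz mulr0; lra.
  have psip : 0 < psi by rewrite lt0r psinz.
  apply: le_of_sub_sqrt; first lra.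
  rewrite -(ler_pM2r psip); apply: le_trans (l1l2_ge psi0 Vge) _.
  exact: le_trans (l1l2_restr_le v VT) split_le.
exists (T :|: V); split.
- exact: subsetUl.
- apply: (@le_trans _ _ (#|T| + #|V|)%:R); first by rewrite ler_nat cardsU leq_subr.
  by rewrite natrD lerD2l.
- by move=> i; rewrite !inE negb_or => /andP[iT0]; rewrite iT0 /= -leNgt.
- by apply: le_trans (l1l2_restr_le v _) split_le; rewrite setCS subsetUl.
Qed.

End Norms.

(** * Tight frame identity, restricted isometry bounds and optimality *)

Section Recovery.
Set Implicit Arguments.
Unset Strict Implicit.
Variables (R : realType) (m n d : nat).
Variables (A : 'M[R]_(m, n)) (D : 'M[R]_(n, d)).
Hypothesis (hD : D *m D^T = 1%:M).

Lemma dotv_adj (k l : nat) (M : 'M[R]_(k, l)) (y : 'cV[R]_k) (v : 'cV[R]_l) :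
  dotv (M^T *m y) v = dotv y (M *m v).
Proof. by rewrite !dotv_mx trmx_mul trmxK mulmxA. Qed.

Lemma norm2_analysis (z : 'cV[R]_n) : norm2 (D^T *m z) = norm2 z.
Proof.
apply/eqP; rewrite -(eqrXn2 (n := 2)) ?norm2_ge0 // !norm2_sq dotv_adj mulmxA.
by rewrite hD mul1mx.
Qed.

(** As D^T is an isometry, |D u|_2^2 = <D^T D u, u> is at most |D u|_2 |u|_2. *)
Lemma norm2_synthesis (u : 'cV[R]_d) : norm2 (D *m u) <= norm2 u.
Proof.
have := dotv_le (D^T *m (D *m u)) u.
rewrite dotv_adj -norm2_sq norm2_analysis expr2.
have [->|nz] := eqVneq (norm2 (D *m u)) 0; first by rewrite norm2_ge0.
by rewrite ler_pM2l // lt0r nz norm2_ge0.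
Qed.

(** With u, v the parts of w on and off [U], one has h = D u + D v and <D u, h> = |u|_2^2. So
    |u|_2^2 - <A D u, A h> splits into |D u|_2^2 - |A D u|_2^2, at most delta |u|_2^2 by the D-RIP,
    and a cross term controlled by the D-ROC through [dotv_polytope]; then |u|_2 is divided out. *)
Lemma block_bound (h : 'cV[R]_n) (U : {set 'I_d}) (k N : nat) (delta theta phi : R) :
  let w := D^T *m h in
  0 <= delta -> 0 <= theta -> DRIP A D k delta -> DROP A D k N theta ->
  (#|U| <= k)%N -> (0 < N)%N -> 0 <= phi ->
  (forall i, i \notin U -> `|w i ord0| <= phi) ->
  norm1 (restr (~: U) w) - norm2 (restr (~: U) w)
    <= (N%:R - Num.sqrt N%:R) * phi ->
  (1 - delta) * norm2 (restr U w)
    <= Num.sqrt (1 + delta) * norm2 (A *m h) + theta * (Num.sqrt N%:R * phi).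
Proof.
move=> w d0 th0 rip rop Uk N0 phi0 wphi l12.
set u := restr U w; set v := restr (~: U) w in l12.
have su : sparse k u by exact: sparse_restr.
have vphi i : `|v i ord0| <= phi.
  by rewrite mxE inE; case: (boolP (i \in U)) => [_|/wphi]; rewrite ?normr0.
have v1 : norm1 v <= N%:R * phi by apply: l1l2_polytope => //; rewrite ler1n.
(* f represents z |-> <D u, D z> - <A D u, A D z>, the form bounded by the D-ROC. *)
pose f := D^T *m (D *m u) - D^T *m (A^T *m (A *m (D *m u))).
have fE z : dotv f z = dotv (D *m u) (D *m z) - dotv (A *m (D *m u)) (A *m (D *m z)).
  by rewrite /f -scaleN1r dotvDl dotvZl mulN1r !dotv_adj.
have fv : dotv f v <= theta * norm2 u * (Num.sqrt N%:R * phi).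
  apply: (@dotv_polytope _ _ f v N phi) => // z sz nz.
  rewrite fE; apply: (@le_trans _ _ (theta * norm2 u * norm2 z)).
    by apply: le_trans (rop u z su sz); rewrite distrC ler_norm.
  by rewrite ler_wpM2l // mulr_ge0 // norm2_ge0.
have uv : u + v = w by exact: restrC.
have Dw : D *m w = h by rewrite mulmxA hD mul1mx.
have e1 : dotv (D *m u) (D *m u) + dotv (D *m u) (D *m v) = norm2 u ^+ 2.
  by rewrite -dotvDr -mulmxDr uv Dw -dotv_restr -/w -/u dotvC -dotv_adj dotvC.
have e2 : dotv (A *m (D *m u)) (A *m (D *m u)) + dotv (A *m (D *m u)) (A *m (D *m v))
   = dotv (A *m (D *m u)) (A *m h).
  by rewrite -dotvDr -!mulmxDr uv Dw.
have [lo up] := rip u su.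
have Du := norm2_synthesis u; have Du0 := norm2_ge0 (D *m u).
have u0 := norm2_ge0 u; have a0 := norm2_ge0 (A *m h).
have Du2 : norm2 (D *m u) ^+ 2 <= norm2 u ^+ 2 by rewrite ler_pXn2r ?nnegrE.
have ADu : norm2 (A *m (D *m u)) <= Num.sqrt (1 + delta) * norm2 u.
  apply: le_norm2; first by rewrite mulr_ge0 ?sqrtr_ge0.
  rewrite exprMn (sqr_sqrtr (addr_ge0 ler01 d0)); apply: le_trans up _.
  by rewrite ler_wpM2l ?addr_ge0.
have cs := dotv_le (A *m (D *m u)) (A *m h).
have cs2 := ler_wpM2r a0 ADu.
have dDu := ler_wpM2l d0 Du2.
move: fv; rewrite fE => fv.
rewrite -!norm2_sq in e1 e2.
set B := Num.sqrt (1 + delta) in cs2 *.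
have key : norm2 u * ((1 - delta) * norm2 u)
    <= norm2 u * (B * norm2 (A *m h) + theta * (Num.sqrt N%:R * phi)) by lra.
have [uz|unz] := eqVneq (norm2 u) 0.
  by rewrite uz mulr0 addr_ge0 ?mulr_ge0 ?sqrtr_ge0.
by move: key; rewrite ler_pM2l // lt0r unz.
Qed.

(** Reverse triangle inequality with [u] as the leading term on [T] and [w] off [T]. *)
Lemma norm1_perturb_ge (T : {set 'I_d}) (u w : 'cV[R]_d) :
  norm1 u - norm1 (restr T w) + norm1 (restr (~: T) w) - 2 * norm1 (restr (~: T) u)
    <= norm1 (u + w).
Proof.
rewrite (norm1_restrC T u) (norm1_restrC T (u + w)).
have : norm1 (restr T u) - norm1 (restr T w) <= norm1 (restr T (u + w)).
  rewrite !norm1_restr -sumrB; apply: ler_sum => i _; rewrite mxE.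
  by rewrite -[X in _ - X]normrN; apply: le_trans (lerB_dist _ _) _; rewrite opprK.
have : norm1 (restr (~: T) w) - norm1 (restr (~: T) u)
    <= norm1 (restr (~: T) (u + w)).
  rewrite !norm1_restr -sumrB; apply: ler_sum => i _; rewrite mxE addrC.
  by rewrite -[X in - X]normrN addrC; apply: le_trans (lerB_dist _ _) _; rewrite opprK addrC.
lra.
Qed.

(** The residuals are A h - e and - e, whose squared norms differ by |A h|_2^2 - 2 <A h, e>;
    Cauchy-Schwarz and |e|_2 <= lambda give the linear term. *)
Lemma optimality (alpha lambda : R) (x h : 'cV[R]_n) (e : 'cV[R]_m) (T : {set 'I_d}) :
  0 <= alpha -> 0 < lambda -> norm2 e <= lambda ->
  objective A D (A *m x + e) lambda alpha (x + h)
    <= objective A D (A *m x + e) lambda alpha x ->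
  norm2 (A *m h) ^+ 2 - 2 * lambda * norm2 (A *m h) <=
    2 * lambda * (norm1 (restr T (D^T *m h)) - norm1 (restr (~: T) (D^T *m h))
                  + alpha * norm2 (D^T *m h) + 2 * norm1 (restr (~: T) (D^T *m x))).
Proof.
move=> al0 l0 he; rewrite /objective.
have -> : A *m (x + h) - (A *m x + e) = A *m h + (- 1) *: e.
  by rewrite scaleN1r mulmxDr opprD addrACA subrr add0r.
have -> : A *m x - (A *m x + e) = (-1) *: e.
  by rewrite scaleN1r opprD addrA subrr add0r.
rewrite mulmxDr; set w := D^T *m h; set a := norm2 (A *m h).
rewrite !norm2_sq dotvDl !dotvDr !dotvZl !dotvZr (dotvC e) -!norm2_sq -/a => hmin.
have n1 := norm1_perturb_ge T (D^T *m x) w.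
have n2 : alpha * norm2 (D^T *m x + w) <= alpha * (norm2 (D^T *m x) + norm2 w).
  by rewrite ler_wpM2l // norm2D.
have cs : dotv (A *m h) e <= a * lambda.
  by apply: le_trans (dotv_le _ _) _; rewrite ler_wpM2l // norm2_ge0.
have n12 := lerB n1 n2.
have := ler_wpM2l (ltW l0) n12; lra.
Qed.

Lemma cone (alpha lambda tail : R) (h : 'cV[R]_n) (T : {set 'I_d}) (w : 'cV[R]_d) :
  0 < lambda ->
  norm2 (A *m h) ^+ 2 - 2 * lambda * norm2 (A *m h) <=
    2 * lambda * (norm1 (restr T w) - norm1 (restr (~: T) w) + alpha * norm2 w + 2 * tail) ->
  norm1 (restr (~: T) w)
    <= norm1 (restr T w) + alpha * norm2 w + (2 * tail + norm2 (A *m h)).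
Proof.
move=> l0 opt; have l20 : 0 < 2 * lambda by lra.
by rewrite -(ler_pM2l l20); have := sqr_ge0 (norm2 (A *m h)); lra.
Qed.

(** Because alpha <= 1, the share alpha |w_Tc|_2 of alpha |w|_2 is absorbed on the left. *)
Lemma l1l2_cone (alpha r : R) (T : {set 'I_d}) (w : 'cV[R]_d) :
  0 <= alpha -> alpha <= 1 ->
  norm1 (restr (~: T) w) <= norm1 (restr T w) + alpha * norm2 w + r ->
  norm1 (restr (~: T) w) - norm2 (restr (~: T) w)
    <= (Num.sqrt #|T|%:R + alpha) * norm2 (restr T w) + r.
Proof.
move=> al0 al1 cone_w; have w1 := norm1_le_norm2 T w.
have wT : norm2 w <= norm2 (restr T w) + norm2 (restr (~: T) w).
  by rewrite -{1}(restrC T w) norm2D.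
have := ler_wpM2l al0 wT.
have : 0 <= (1 - alpha) * norm2 (restr (~: T) w).
  by rewrite mulr_ge0 ?norm2_ge0 // subr_ge0.
lra.
Qed.

(** The level [phi] rewrites the right side of the cone condition as (s - sqrt s) phi. It dominates
    [c] because sqrt s c <= |w_T|_2, hence (s - sqrt s) c <= (sqrt s - 1) |w_T|_2. *)
Lemma cone_level (alpha r c phi : R) (s : nat) (T : {set 'I_d}) (w : 'cV[R]_d) :
  0 <= alpha -> alpha <= 1 -> 0 <= r -> (2 <= s)%N -> #|T| = s ->
  0 <= c -> (forall i, i \in T -> c <= `|w i ord0|) ->
  norm1 (restr (~: T) w) <= norm1 (restr T w) + alpha * norm2 w + r ->
  (s%:R - Num.sqrt s%:R) * phi = (Num.sqrt s%:R + alpha) * norm2 (restr T w) + r ->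
  [/\ 0 <= phi, c <= phi &
      norm1 (restr (~: T) w) - norm2 (restr (~: T) w) <= (s%:R - Num.sqrt s%:R) * phi].
Proof.
move=> al0 al1 r0 s2 cT c0 Tge cone_w phiE.
have cp := norm2_restr_ge c0 Tge; rewrite cT in cp.
have l12 := l1l2_cone al0 al1 cone_w; rewrite cT -phiE in l12.
have sq2 : s%:R = Num.sqrt s%:R ^+ 2 :> R by rewrite sqr_sqrtr ?ler0n.
have s1 : 1 < s%:R :> R by rewrite ltr1n.
have sq1 : 1 < Num.sqrt s%:R :> R.
  by rewrite -[ltLHS]sqrtr1 ltr_sqrt // (lt_trans ltr01).
move: (norm2_ge0 (restr T w)) cp phiE l12 sq1 sq2.
move: (norm2 (restr T w)) (Num.sqrt s%:R) => p sq p0 cp phiE l12 sq1 sq2.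
have s_sq : 0 < s%:R - sq.
  have -> : s%:R - sq = sq * (sq - 1) by rewrite sq2; ring.
  by rewrite mulr_gt0; lra.
have c_phi : c <= phi.
  rewrite -(ler_pM2l s_sq) phiE sq2.
  have h1 : (sq - 1) * (sq * c) <= (sq - 1) * p by rewrite ler_wpM2l //; lra.
  have h2 : 0 <= alpha * p by rewrite mulr_ge0.
  lra.
split=> //; exact: le_trans c_phi.
Qed.

(** The argument shared by both parts, which supply [U], the orders [k] and [N], the level [phi] off
    [U], and the factor [G] relating that level to the cone condition. *)
Lemma recovery (alpha lambda tail a : R) (h : 'cV[R]_n) (s : nat) (T : {set 'I_d}) (c : R)
    (U : {set 'I_d}) (k N : nat) (delta theta phi G rho tau C : R) :
  let w := D^T *m h in
  let sq := Num.sqrt s%:R in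
  let p := norm2 (restr T w) in
  let K := Num.sqrt ((alpha + sq) / sq + alpha ^+ 2 / (4 * s%:R))
           + (alpha + 1) / (2 * sq) + 1 in
  let Q := C * (1 - rho) + (sq + alpha) * Num.sqrt (1 + delta) in
  0 < alpha -> alpha <= 1 -> 0 < lambda -> 0 <= tail -> (0 < s)%N -> a = norm2 (A *m h) ->
  #|T| = s -> 0 <= c -> (forall i, i \in T -> c <= `|w i ord0|) ->
  (forall i, i \notin T -> `|w i ord0| <= c) ->
  a ^+ 2 - 2 * lambda * a <=
    2 * lambda * (norm1 (restr T w) - norm1 (restr (~: T) w) + alpha * norm2 w + 2 * tail) ->
  0 <= delta -> 0 <= theta -> DRIP A D k delta -> DROP A D k N theta ->
  T \subset U -> (#|U| <= k)%N -> (0 < N)%N -> 0 <= phi ->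
  (forall i, i \notin U -> `|w i ord0| <= phi) ->
  norm1 (restr (~: U) w) - norm2 (restr (~: U) w) <= (N%:R - Num.sqrt N%:R) * phi ->
  Num.sqrt N%:R * phi = G * ((sq + alpha) * p + (2 * tail + a)) ->
  0 <= G -> delta + theta * G * (sq + alpha) <= rho -> rho < 1 ->
  0 <= tau -> theta * G <= tau * (1 - rho) -> C = 1 + (sq + alpha) * tau ->
  norm2 h <= err_bound K tau C Q rho delta alpha sq tail lambda.
Proof.
move=> w sq p K Q al0 al1 l0 tail0 s0 aE cT c0 Tge Tle opt.
move=> d0 th0 rip rop TU Uk N0 phi0 wphi l12 phiE G0 rho_ge rho1 tau0 tau_ge CE.
have sq0 : 0 < sq by rewrite sqrtr_gt0 ltr0n.
have sq2 : s%:R = sq ^+ 2 by rewrite sqr_sqrtr ?ler0n.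
have a0 : 0 <= a by rewrite aE norm2_ge0.
have p0 : 0 <= p by exact: norm2_ge0.
pose y := norm2 (restr (~: T) w); have y0 : 0 <= y by exact: norm2_ge0.
have wpy : norm2 w <= p + y by rewrite -{1}(restrC T w) norm2D.
have alw : alpha * norm2 w <= alpha * p + alpha * y.
  by rewrite -mulrDr ler_wpM2l // ltW.
have w1p : norm1 (restr T w) <= sq * p by rewrite /sq -cT norm1_le_norm2.
have cp : sq * c <= p by rewrite /sq -cT norm2_restr_ge.
have y1 : y <= norm1 (restr (~: T) w) by exact: norm2_le_norm1.
have cone_w : norm1 (restr (~: T) w)
    <= norm1 (restr T w) + alpha * norm2 w + (2 * tail + a).
  by rewrite aE; apply: cone l0 _; rewrite -aE.
have Ha : a ^+ 2 - 2 * lambda * a <= 2 * lambda * ((sq + alpha) * p + 2 * tail).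
  apply: le_trans opt _; apply: ler_wpM2l; first lra.
  have : 0 <= (1 - alpha) * y by rewrite mulr_ge0 // subr_ge0.
  lra.
(* Entries off T are at most c <= p / sq, so y^2 <= (p / sq) |w_Tc|_1, and the cone condition bounds
   the 1-norm. *)
have Hy : y ^+ 2 <= p / sq * ((sq + alpha) * p + alpha * y + (2 * tail + a)).
  have yc : y ^+ 2 <= c * norm1 (restr (~: T) w).
    apply: norm2_sq_le_sup => i; rewrite restrE inE.
    by case: (boolP (i \in T)) => [_|/Tle]; rewrite ?normr0.
  apply: le_trans yc _; apply: ler_pM => //; first exact: norm1_ge0.
    by rewrite ler_pdivlMr // mulrC.
  lra.
(* The D-ROC term contains theta G (sq + alpha) p. As p is at most the norm on [U], it moves to the
   left side, where [rho] replaces [delta]. *)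
have Hp : (1 - rho) * p <= Num.sqrt (1 + delta) * a + tau * (1 - rho) * (2 * tail + a).
  have blk := block_bound d0 th0 rip rop Uk N0 phi0 wphi l12.
  have pU : p <= norm2 (restr U w) by exact: norm2_restr_le.
  move: blk; rewrite -aE phiE -/w; set P := norm2 (restr U w) in pU *.
  set B := Num.sqrt (1 + delta) => blk.
  have r0 : 0 <= 1 - rho by lra.
  have tG : 0 <= theta * G by rewrite mulr_ge0.
  have tGs : 0 <= theta * G * (sq + alpha) by rewrite mulr_ge0 //; lra.
  have h1 := ler_wpM2l r0 pU.
  have h2 := ler_wpM2l tGs pU.
  have P0 : 0 <= P by lra.
  have h3 := ler_wpM2r P0 rho_ge.
  have R0 : 0 <= 2 * tail + a by lra.
  have h4 := ler_wpM2r R0 tau_ge.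
  lra.
rewrite -(norm2_analysis h) -/w.
apply: le_trans wpy _.
have R0 : 0 <= 2 * tail + a by lra.
apply: le_trans (tail_norm_le sq0 (ltW al0) p0 y0 R0 Hy) _.
rewrite -sq2 -/K.
apply: (err_bound_ge l0 (ltW al0) sq0 tau0 _ rho1 tail0 p0 a0 CE erefl Hp Ha).
have al1' : 0 <= (alpha + 1) / (2 * sq) by rewrite divr_ge0 ?mulr_ge0 ?(ltW sq0) //; lra.
by rewrite /K !addr_ge0 ?sqrtr_ge0.
Qed.

End Recovery.

Theorem theorem1 (R : realType) (m n d : nat)
  (A : 'M[R]_(m, n)) (D : 'M[R]_(n, d)) (hD : D *m D^T = 1%:M)
  (alpha lambda : R) (halpha0 : 0 < alpha) (halpha1 : alpha <= 1) (hlambda : 0 < lambda)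
  (s : nat) (hs : (2 <= s)%N)
  (x : 'cV[R]_n) (e : 'cV[R]_m) (b : 'cV[R]_m) (hb : b = A *m x + e)
  (he : norm2 e <= lambda)
  (T : {set 'I_d}) (hTcard : #|T| = s)
  (hT : forall i j, i \in T -> j \notin T -> `|(D^T *m x) j ord0| <= `|(D^T *m x) i ord0|)
  (xhat : 'cV[R]_n)
  (hmin : forall z : 'cV[R]_n,
      objective A D b lambda alpha xhat <= objective A D b lambda alpha z) :
  let sq := Num.sqrt (s%:R : R) in
  let sqrt2 := Num.sqrt (2 : R) in
  let K := Num.sqrt ((alpha + sq) / sq + alpha ^+ 2 / (4 * s%:R))
           + (alpha + 1) / (2 * sq) + 1 in
  let tail := norm1 ((colrestr D (~: T))^T *m x) in
  (* part (i) *)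
  (forall (t : R) (delta theta : R), 3 <= t ->
     is_DRIC A D (ceiln (t * s%:R)) delta ->
     is_DROC A D (ceiln (t * s%:R)) (ceiln ((t - 1) * s%:R)) theta ->
     let rho := delta + Num.sqrt ((ceiln ((t - 1) * s%:R))%:R / ((t - 1) ^+ 2 * s%:R))
                 * ((sqrt2 + 1) * (sq + alpha) / (sqrt2 * (sq - 1))) * theta in
     rho < 1 ->
     let tau := (sqrt2 + 1) * theta / (sqrt2 * (1 - rho))
                * (Num.sqrt ((t - 1) * s%:R) / ((t - 1) * (s%:R - sq))) in
     let C := 1 + (sqrt2 + 1) * theta / (sqrt2 * (1 - rho))
                  * ((sq + alpha) / (s%:R - sq)) * (Num.sqrt ((t - 1) * s%:R) / (t - 1)) in
     let Q := C * (1 - rho) + (sq + alpha) * Num.sqrt (1 + delta) in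
     norm2 (xhat - x) <= err_bound K tau C Q rho delta alpha sq tail lambda)
  /\
  (* part (ii) *)
  (forall (delta theta : R),
     is_DRIC A D s delta ->
     is_DROC A D s s theta ->
     let rho := delta + (sqrt2 + 1) * (sq + alpha) / (sqrt2 * (sq - 1)) * theta in
     rho < 1 ->
     let tau := (sqrt2 + 1) * theta / (sqrt2 * (1 - rho)) * (1 / (sq - 1)) in
     let C := 1 + (sqrt2 + 1) * theta / (sqrt2 * (1 - rho)) * ((sq + alpha) / (sq - 1)) in
     let Q := C * (1 - rho) + (sq + alpha) * Num.sqrt (1 + delta) in
     norm2 (xhat - x) <= err_bound K tau C Q rho delta alpha sq tail lambda).
Proof.
move=> sq sqrt2 K tail.
simpl in (type of sq), (type of sqrt2).
pose h := xhat - x; pose w := D^T *m h; pose a := norm2 (A *m h).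
have s0 : (0 < s)%N by exact: ltnW.
have sd : (s <= d)%N by rewrite -hTcard -[leqRHS]card_ord max_card.
have [T0 [c [cT0 c0 T0ge T0le]]] := top_restr w sd.
have al0 : 0 <= alpha by exact: ltW.
have tailE : tail = norm1 (restr (~: T) (D^T *m x)).
  apply: eq_bigr => i _; congr `|_|; rewrite restrE !mxE; case: ifP => iT.
    by apply: eq_bigr => j _; rewrite !mxE iT.
  by apply: big1 => j _; rewrite !mxE iT mul0r.
have tail0 : 0 <= tail by rewrite tailE norm1_ge0.
have opt : a ^+ 2 - 2 * lambda * a <=
    2 * lambda * (norm1 (restr T0 w) - norm1 (restr (~: T0) w) + alpha * norm2 w + 2 * tail).
  (* T0 maximizes |w_S|_1 among sets S of size s, so the inequality passes from T to T0. *)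
  have TT0 : norm1 (restr T w) <= norm1 (restr T0 w).
    by apply: norm1_top_le T0ge T0le; rewrite cT0.
  have optT : a ^+ 2 - 2 * lambda * a <= 2 * lambda * (norm1 (restr T w)
      - norm1 (restr (~: T) w) + alpha * norm2 w + 2 * tail).
    rewrite tailE; apply: (optimality _ al0 hlambda he).
    by rewrite [x + _]subrKC -hb.
  apply: le_trans optT _; rewrite ler_wpM2l ?mulr_ge0 ?(ltW hlambda) //.
  by have := norm1_restrC T w; have := norm1_restrC T0 w; clear -TT0; lra.
have sq2 : s%:R = sq ^+ 2 by rewrite sqr_sqrtr ?ler0n.
have sq1 : 1 < sq by rewrite -sqrtr1 ltr_sqrt ?ltr0n // ltr1n.
pose r := 2 * tail + a.
have r0 : 0 <= r by rewrite addr_ge0 ?mulr_ge0 ?norm2_ge0.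
have s_sqE : (s%:R : R) - sq = (sq - 1) * sq by rewrite sq2; ring.
have sq_neq1 : sq - 1 != 0 by rewrite gt_eqF // subr_gt0.
have s_sq : (s%:R : R) - sq != 0.
  by rewrite s_sqE mulf_neq0 // gt_eqF // (lt_trans ltr01).
(* This level makes the cone condition read |w_T0c|_1 - |w_T0c|_2 <= (s - sqrt s) phi, the shape
   required by [l1l2_split] and, in part (ii), by [block_bound]. *)
have [phi phiE] : exists phi, (s%:R - sq) * phi = (sq + alpha) * norm2 (restr T0 w) + r.
  by exists (((sq + alpha) * norm2 (restr T0 w) + r) / (s%:R - sq)); rewrite mulrC divfK.
have [phi0 c_phi l12] := cone_level al0 halpha1 r0 hs cT0 c0 T0ge (cone hlambda opt) phiE.
have T0phi i : i \notin T0 -> `|w i ord0| <= phi.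
  by move=> /T0le wi; apply: le_trans c_phi.
split.
- move=> t delta theta t3 [d0 rip _] [th0 rop _] rho rho1.
  pose tau := (sqrt2 + 1) * theta / (sqrt2 * (1 - rho))
              * (Num.sqrt ((t - 1) * s%:R) / ((t - 1) * (s%:R - sq))).
  pose C := 1 + (sqrt2 + 1) * theta / (sqrt2 * (1 - rho))
              * ((sq + alpha) / (s%:R - sq)) * (Num.sqrt ((t - 1) * s%:R) / (t - 1)).
  pose Q := C * (1 - rho) + (sq + alpha) * Num.sqrt (1 + delta).
  change (is_true (norm2 h <= err_bound K tau C Q rho delta alpha sq tail lambda)).
  have s2 : 2 <= s%:R :> R by rewrite (ler_nat _ 2).
  have t1 : 1 <= t - 1 by clear -t3; lra.
  have M4 : 4 <= (t - 1) * s%:R by clear -s2 t3; nra.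
  have M0 : 0 <= (t - 1) * s%:R by exact: le_trans M4.
  have /andP[MN /ltW NM] := ceiln_bounds M0.
  have /andP[tsk _] : t * s%:R <= (ceiln (t * s%:R))%:R < t * s%:R + 1.
    by apply: ceiln_bounds; clear -s2 t3; nra.
  have [G0 rho_ge tau0 tau_ge] :=
    @constants_large _ _ _ _ _ _ _ _ rho tau _ sq1 sq2 t3 al0 th0 M4 MN NM erefl rho1 erefl erefl.
  (* With q = t - 1 the set [U] has at most s + (t - 1) s = t s elements, which matches the first
     D-ROC order. *)
  have [U [TU cU Uphi Ul12]] := l1l2_split s2 t1 phi0 T0phi l12.
  apply: (recovery hD halpha0 halpha1 hlambda tail0 s0 erefl cT0 c0 T0ge T0le opt
    d0 th0 rip rop TU _ _ _ Uphi _ _ G0 rho_ge rho1 tau0 tau_ge) => //.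
  + rewrite -(ler_nat R); apply: le_trans cU _; apply: le_trans tsk.
    by rewrite cT0; clear; lra.
  + by rewrite -(ltr_nat R); apply: lt_le_trans MN; apply: lt_le_trans M4.
  + by rewrite divr_ge0 // (le_trans ler01).
  + apply: le_trans Ul12 _; rewrite ler_wpM2r ?divr_ge0 ?(le_trans ler01 t1) //.
    by apply: sub_sqrt_le => //; apply: le_trans M4; rewrite (ler_nat _ 1 4).
  + rewrite -/sq -/r -phiE; have : t - 1 != 0 by rewrite gt_eqF // (lt_le_trans ltr01).
    by clear -s_sq => t10; field; rewrite s_sq.
  + by rewrite /C /tau -/sq [((t - 1) * _)^-1]invfM; ring.
- move=> delta theta [d0 rip _] [th0 rop _] rho rho1.
  pose tau := (sqrt2 + 1) * theta / (sqrt2 * (1 - rho)) * (1 / (sq - 1)).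
  pose C := 1 + (sqrt2 + 1) * theta / (sqrt2 * (1 - rho)) * ((sq + alpha) / (sq - 1)).
  pose Q := C * (1 - rho) + (sq + alpha) * Num.sqrt (1 + delta).
  change (is_true (norm2 h <= err_bound K tau C Q rho delta alpha sq tail lambda)).
  have [G0 rho_ge tau0 tau_ge] :=
    @constants_s _ _ _ _ _ rho tau sq1 al0 th0 erefl rho1 erefl.
  (* [U] is T0 itself and both orders equal s, so [phi] serves unchanged as the level and G = 1 /
     (sqrt s - 1). *)
  apply: (recovery hD halpha0 halpha1 hlambda tail0 s0 erefl cT0 c0 T0ge T0le opt
    d0 th0 rip rop (subxx _) _ s0 phi0 T0phi l12 _ G0 rho_ge rho1 tau0 tau_ge).
  + by rewrite cT0.
  + by rewrite -/sq -/r -phiE s_sqE -mulrA mulKf.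
  + by rewrite /C /tau -/sq; ring.
Qed.
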